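(* Let $K\in\mathbb R\setminus\{0\}$ and $N\in(0,\infty]$ (with $\frac1\infty=0$), and let $(X,d_t,m_t)_{t\in I}$, $I=(0,T)$, be a time-dependent metric measure space satisfying the standing assumptions in the context. Assume that it is a super-$(K,N)$-Ricci flow in the sense that for a.e. $t\in I$ and every $W_t$-geodesic $(\mu^a)_{a\in[0,1]}$ in $\mathcal P(X)$ with $\mu^0,\mu^1\in\mathrm{Dom}(S)$ $$\partial_a^+S_t(\mu^a)\big|_{a=1-}-\partial_a^-S_t(\mu^a)\big|_{a=0+}\ge-\frac12\,\partial_t^-W_{t-}^2(\mu^0,\mu^1)+\frac1N\big|S_t(\mu^0)-S_t(\mu^1)\big|^2+K\,W_t^2(\mu^0,\mu^1).$$ Then for each $C\in\mathbb R$ the time-dependent metric measure space $(X,\tilde d_t,\tilde m_t)_{t\in\tilde I}$ is a super-$N$-Ricci flow, where $$\tilde d_t=e^{-K\tau(t)}d_{\tau(t)},\qquad\tilde m_t=m_{\tau(t)},\qquad\tau(t)=\frac{-1}{2K}\log(C-2Kt),\qquad\tilde I=\{t\in\mathbb R:\ 2Kt<C,\ \tau(t)\in I\}.$$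
   Context: Standing assumptions. $I=(0,T)$ with $0<T<\infty$; $X$ is a compact space equipped with one-parameter families $(d_t)_{t\in I}$ of geodesic metrics (inducing the topology of $X$) and $(m_t)_{t\in I}$ of Borel measures. There are constants $C_0,L,K_0,N'\in\mathbb R$ such that for all $s,t\in I$ and $x,y\in X$: (a) the metrics are uniformly bounded and $|\log(d_t(x,y)/d_s(x,y))|\le L|t-s|$; (b) $m_t=e^{-f_t}m_\diamond$ for a reference measure $m_\diamond$, with $|f_t(x)|\le C_0$, $|f_t(x)-f_t(y)|\le C_0\,d_t(x,y)$ and $|f_s(x)-f_t(x)|\le L|s-t|$; (c) for each $t$ the static space $(X,d_t,m_t)$ satisfies RCD$^*(K_0,N')$. Notation. $\mathcal P(X)$ is the set of Borel probability measures, $W_t$ the $L^2$-Kantorovich-Wasserstein distance induced by $d_t$. $S_t(\mu)=\int u\log u\,dm_t$ if $\mu=u\,m_t$ and $S_t(\mu)=\infty$ otherwise; $\mathrm{Dom}(S)=\{S_t<\infty\}$ is independent of $t$. $\partial_a^+S_t(\mu^a)|_{a=1-}=\limsup_{a\nearrow1}\frac{S_t(\mu^1)-S_t(\mu^a)}{1-a}$, $\partial_a^-S_t(\mu^a)|_{a=0+}=\liminf_{a\searrow0}\frac{S_t(\mu^a)-S_t(\mu^0)}{a}$, $\partial_t^-W_{t-}^2(\mu,\nu)=\liminf_{s\nearrow t}\frac{W_t^2(\mu,\nu)-W_s^2(\mu,\nu)}{t-s}$. A time-dependent metric measure space $(X,d_t,m_t)_{t\in I}$ is a super-$N$-Ricci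 flow if for a.e. $t\in I$ and every $W_t$-geodesic $(\mu^a)_{a\in[0,1]}$ with $\mu^0,\mu^1\in\mathrm{Dom}(S)$: $\partial_a^+S_t(\mu^a)|_{a=1-}-\partial_a^-S_t(\mu^a)|_{a=0+}\ge-\frac12\partial_t^-W_{t-}^2(\mu^0,\mu^1)+\frac1N|S_t(\mu^0)-S_t(\mu^1)|^2$. For $(X,\tilde d_t,\tilde m_t)_{t\in\tilde I}$ this is meant with the entropies $\tilde S_t$ and Wasserstein distances $\tilde W_t$ defined from $\tilde m_t$, $\tilde d_t$. *)

(* Defs.v *)
From mathcomp Require Import all_boot all_order all_algebra.
From mathcomp Require Import all_classical all_reals all_analysis.

Set Implicit Arguments.
Unset Strict Implicit.
Unset Printing Implicit Defensive.

Import Order.TTheory GRing.Theory Num.Theory.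
Import numFieldNormedType.Exports.

Local Open Scope classical_set_scope.
Local Open Scope ring_scope.

(* X with its Borel sigma-algebra. MathComp-Analysis only makes this a
   measurableType when X is pointed. *)
Notation borel X := (g_sigma_algebraType (@open X)).

Section metrics.
Context {R : realType} {X : ptopologicalType}.
Implicit Types d : X -> X -> R.

Definition is_metric d :=
  [/\ forall x y, 0 <= d x y,
      forall x y, d x y = 0 <-> x = y,
      forall x y, d x y = d y x
    & forall x y z, d x z <= d x y + d y z].

Definition induces_topology d :=
  forall (x : X) (A : set X),
    nbhs x A <-> exists2 r : R, 0 < r & [set y | d x y < r] `<=` A.

Definition geodesic_metric d := is_metric d /\
  forall x y, exists g : R -> X, [/\ g 0 = x, g 1 = y &
    forall s t, s \in `[0, 1] -> t \in `[0, 1] ->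
      d (g s) (g t) = `|s - t| * d x y].

Definition lipschitz_for d (f : X -> R) :=
  exists L : R, forall x y, `|f x - f y| <= L * d x y.

(* The value at y = x is 0 / 0 = 0. As all quotients are nonnegative this does
   not affect the limsup, and it gives slope 0 at isolated points. *)
Definition slope d (f : X -> R) (x : X) : \bar R :=
  limf_esup (fun y : X => (`|f y - f x| / d x y)%:E) (nbhs x).

End metrics.

Section measures.
Context {R : realType} {X : ptopologicalType}.
Implicit Types (d : X -> X -> R) (m : {measure set (borel X) -> \bar R})
  (mu nu : probability (borel X) R) (u rho : borel X -> R).
Local Open Scope ereal_scope.

(* Measures are functions on all subsets of X, with meaningless values outside
   the sigma-algebra; this is equality of the actual Borel measures. *)
Definition same_measure mu nu := forall A, measurable A -> mu A = nu A.

Definition locally_finite m :=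
  forall x : X, exists2 U : set X, nbhs x U & measurable (U : set (borel X))
    /\ m U < +oo.

Definition is_density m mu u :=
  [/\ measurable_fun [set: borel X] u, forall x, (0 <= u x)%R &
      forall A, measurable A -> mu A = \int[m]_(x in A) (u x)%:E].

(* The density is unique m-a.e., so its choice is irrelevant. ln 0 = 0. *)
Definition entropy m mu : \bar R :=
  if pselect (exists u, is_density m mu u) is left h then
    let u := projT1 (cid h) in \int[m]_x (u x * ln (u x))%:E
  else +oo.

Definition coupling mu nu (q : probability (borel X * borel X)%type R) :=
  forall A, measurable A -> q (A `*` setT) = mu A /\ q (setT `*` A) = nu A.

Definition transport_cost d (q : probability (borel X * borel X)%type R) :=
  \int[q]_z (d z.1 z.2 ^+ 2)%:E.

(* [fine] is harmless: the cost is finite for bounded d, in particular for any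
   metric inducing the topology of a compact space. *)
Definition W2 d mu nu : R :=
  Num.sqrt (fine (ereal_inf [set transport_cost d q | q in coupling mu nu])).

Definition optimal_coupling d mu nu q :=
  coupling mu nu q /\ transport_cost d q = (W2 d mu nu ^+ 2)%:E.

(* A curve indexed by [0, 1]: the values of mu elsewhere are irrelevant. *)
Definition W2_geodesic d (mu : R -> probability (borel X) R) :=
  forall s t : R, s \in `[0%R, 1%R] -> t \in `[0%R, 1%R] ->
    W2 d (mu s) (mu t) = (`|s - t| * W2 d (mu 0) (mu 1))%R.

(* Reduced curvature-dimension condition CD^*(K, N) of Bacher and Sturm. *)

Definition sinh (x : R) : R := (expR x - expR (- x)) / 2.

Definition sigma_coef (t K N theta : R) : \bar R :=
  if (N * pi ^+ 2 <= K * theta ^+ 2)%R then +oo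
  else if (0 < K * theta ^+ 2)%R then
    (sin (t * theta * Num.sqrt (K / N)) / sin (theta * Num.sqrt (K / N)))%:E
  else if (K * theta ^+ 2 == 0)%R then t%:E
  else (sinh (t * theta * Num.sqrt (- K / N)) /
        sinh (theta * Num.sqrt (- K / N)))%:E.

(* S_N(mu | m) for mu = rho m *)
Definition renyi_entropy (N : R) mu rho : \bar R :=
  - \int[mu]_x (rho x `^ (- N^-1))%:E.

(* The original definition also asks the measures to have bounded support,
   which is automatic on a compact space. *)
Definition CDstar d m (K N : R) :=
  forall nu0 nu1 rho0 rho1, is_density m nu0 rho0 -> is_density m nu1 rho1 ->
  exists q (Gamma : R -> probability (borel X) R),
    [/\ optimal_coupling d nu0 nu1 q, W2_geodesic d Gamma,
        same_measure (Gamma 0%R) nu0, same_measure (Gamma 1%R) nu1 &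
        forall t : R, t \in `[0%R, 1%R] ->
        exists2 rho, is_density m (Gamma t) rho &
        forall N' : R, (N <= N')%R ->
          renyi_entropy N' (Gamma t) rho <=
          - \int[q]_z
              (sigma_coef (1 - t) K N' (d z.1 z.2)
                 * (rho0 z.1 `^ (- N'^-1))%:E
               + sigma_coef t K N' (d z.1 z.2)
                 * (rho1 z.2 `^ (- N'^-1))%:E)].

(* Cheeger energy: the L^2(m)-relaxation of the slope energy of Lipschitz
   functions. *)
Definition cheeger d m (f : borel X -> R) : \bar R :=
  ereal_inf [set limn_einf (fun n : nat =>
                   (2^-1)%:E * \int[m]_x (slope d (g n) x ^+ 2)) |
    g in [set g : nat -> borel X -> R |
      (forall n, lipschitz_for d (g n)) /\
      (fun n => 'N[m]_2%:E [EFin \o (g n \- f)%R]) @ \oo --> 0]].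

Definition infinitesimally_hilbertian d m :=
  forall f g : borel X -> R, f \in Lfun m 2%:E -> g \in Lfun m 2%:E ->
    cheeger d m (f \+ g)%R + cheeger d m (f \- g)%R =
    2%:E * cheeger d m f + 2%:E * cheeger d m g.

Definition RCDstar d m (K N : R) :=
  [/\ (1 <= N)%R, locally_finite m, CDstar d m K N
    & infinitesimally_hilbertian d m].

End measures.

Section flows.
Context {R : realType} {X : ptopologicalType}.
Implicit Types (I : set R) (d : R -> X -> X -> R)
  (m : R -> {measure set (borel X) -> \bar R}).

(* Time-dependent objects are indexed by all of R; only times in I matter. *)

Definition time_dependent_geodesic_metrics I d :=
  forall t, I t -> geodesic_metric (d t) /\ induces_topology (d t).

Definition standing_assumptions I d m :=
  time_dependent_geodesic_metrics I d /\
  exists C0 L K0 N' : R,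
  [/\ exists D : R, forall t x y, I t -> d t x y <= D,
      forall s t x y, I s -> I t -> x <> y ->
        `|ln (d t x y / d s x y)| <= L * `|t - s|,
      exists (mref : {measure set (borel X) -> \bar R}) (f : R -> borel X -> R),
        (forall t, I t ->
          [/\ measurable_fun [set: borel X] (f t),
              forall A, measurable A ->
                m t A = (\int[mref]_(x in A) (expR (- f t x))%:E)%E,
              forall x, `|f t x| <= C0
            & forall x y, `|f t x - f t y| <= C0 * d t x y]) /\
        (forall s t x, I s -> I t -> `|f s x - f t x| <= L * `|s - t|)
    & forall t, I t -> RCDstar (d t) (m t) K0 N'].

Local Open Scope ereal_scope.

Definition dplus_entropy_1 (mt : {measure set (borel X) -> \bar R})
    (mu : R -> probability (borel X) R) : \bar R :=
  limf_esup (fun a : R => (entropy mt (mu 1%R) - entropy mt (mu a))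
                          * ((1 - a)^-1)%:E) (1%R : R)^'-.

Definition dminus_entropy_0 (mt : {measure set (borel X) -> \bar R})
    (mu : R -> probability (borel X) R) : \bar R :=
  limf_einf (fun a : R => (entropy mt (mu a) - entropy mt (mu 0%R))
                          * (a^-1)%:E) (0%R : R)^'+.

Definition dminus_W2sq d (t : R) (mu nu : probability (borel X) R) : \bar R :=
  limf_einf (fun s : R =>
    ((W2 (d t) mu nu ^+ 2 - W2 (d s) mu nu ^+ 2) / (t - s))%:E) t^'-.

(* N^-1 = 0 for N = +oo. *)
Definition super_N_Ricci_flow I d m (N : \bar R) :=
  {ae @lebesgue_measure R, forall t, I t ->
    forall mu : R -> probability (borel X) R, W2_geodesic (d t) mu ->
    entropy (m t) (mu 0%R) < +oo -> entropy (m t) (mu 1%R) < +oo ->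
    dplus_entropy_1 (m t) mu - dminus_entropy_0 (m t) mu >=
      - (2^-1)%:E * dminus_W2sq d t (mu 0%R) (mu 1%R)
      + N^-1 * `|entropy (m t) (mu 0%R) - entropy (m t) (mu 1%R)| ^+ 2}.

Definition super_KN_Ricci_flow I d m (K : R) (N : \bar R) :=
  {ae @lebesgue_measure R, forall t, I t ->
    forall mu : R -> probability (borel X) R, W2_geodesic (d t) mu ->
    entropy (m t) (mu 0%R) < +oo -> entropy (m t) (mu 1%R) < +oo ->
    dplus_entropy_1 (m t) mu - dminus_entropy_0 (m t) mu >=
      - (2^-1)%:E * dminus_W2sq d t (mu 0%R) (mu 1%R)
      + N^-1 * `|entropy (m t) (mu 0%R) - entropy (m t) (mu 1%R)| ^+ 2
      + (K * W2 (d t) (mu 0%R) (mu 1%R) ^+ 2)%:E}.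

End flows.

Section time_change.
Context {R : realType} {X : ptopologicalType}.

Definition tau (K C t : R) : R := -1 / (2 * K) * ln (C - 2 * K * t).

Definition I_tilde (K C : R) (I : set R) : set R :=
  [set t | 2 * K * t < C /\ I (tau K C t)].

Definition d_tilde (K C : R) (d : R -> X -> X -> R) (t : R) (x y : X) : R :=
  expR (- K * tau K C t) * d (tau K C t) x y.

Definition m_tilde (K C : R) (m : R -> {measure set (borel X) -> \bar R})
    (t : R) : {measure set (borel X) -> \bar R} := m (tau K C t).

End time_change.

(* Main.v *)
Require Import Defs.
From mathcomp Require Import all_boot all_order all_algebra.
From mathcomp Require Import all_classical all_reals all_analysis.
From mathcomp Require Import ring lra measurable_realfun.

Set Implicit Arguments.
Unset Strict Implicit.
Unset Printing Implicit Defensive.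

Import Order.TTheory GRing.Theory Num.Theory.
Import numFieldNormedType.Exports.

Local Open Scope classical_set_scope.
Local Open Scope ring_scope.

(** The time change is chosen so that the conformal factor of the squared
    distance, [expR (- K * tau t) ^+ 2 = C - 2 * K * t], is affine in time with
    slope [- 2 * K] and is at the same time the reciprocal of the derivative of
    [tau].  Write [E t] for this factor and [w a] for [W2 (d a) mu nu ^+ 2].
    Since [W2] is homogeneous in the metric ([W2Z]), the squared distance of the
    rescaled flow is [E t * w (tau t)], and its backward difference quotient is
<<
      (E t * w (tau t) - E s * w (tau s)) / (t - s)
        = E s * ((tau t - tau s) / (t - s))
            * ((w (tau t) - w (tau s)) / (tau t - tau s))
          - 2 * K * w (tau t).
>>
    The product [E s * ((tau t - tau s) / (t - s))] tends to [1] as [s]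
    increases to [t] ([tau_slope]), so the lower derivative of the rescaled squared distance is at least the original
    one minus [2 * K * w (tau t)] ([dminus_W2sq_time_change]).  Multiplied by
    [- 1 / 2], the correction becomes [K * w (tau t)], which is exactly the term
    that the super-(K, N) inequality has in addition.  Everything else in that
    inequality is unchanged: the measures, hence the entropies, are those at
    time [tau t], and a constant factor does not change which curves are
    geodesics ([W2_geodesicZ]).

    The exceptional times are carried back by the inverse of [tau], which is
    Lipschitz on the bounded interval of original times.  Lipschitz maps
    preserve null sets ([lipschitz_image_negligible]), so the inequality still
    holds at almost every time. *)

(** * Homogeneity of the Wasserstein distance *)

Section integral_scale.
Import HBNNSimple.
Local Open Scope ereal_scope.

(** The integral of a nonnegative function is the supremum of the integrals of
    the simple functions below it, and scaling permutes these simple functions.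
    Arguing on the suprema lets the identity be applied to transport costs
    directly: whether the metric is measurable for the product of the Borel
    sigma-algebras is then not an issue. *)
Lemma ge0_integral_pZl disp (Y : measurableType disp) (R : realType)
    (mu : {measure set Y -> \bar R}) (f : Y -> \bar R) (k : R) :
  (0 < k)%R -> (forall x, 0 <= f x) ->
  \int[mu]_x (k%:E * f x) = k%:E * \int[mu]_x f x.
Proof.
move=> k0 f0.
have gen (r : R) (h : Y -> \bar R) : (0 < r)%R -> (forall x, 0 <= h x) ->
    r%:E * \int[mu]_x h x <= \int[mu]_x (r%:E * h x).
  move=> r0 h0.
  have rh0 x : 0 <= r%:E * h x by rewrite mule_ge0// lee_fin ltW.
  rewrite ge0_integralTE// [leRHS]ge0_integralTE// -ereal_sup_pZl//.
  apply: ge_ereal_sup => _ [_ [s /= sh <-] <-].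
  apply: ereal_sup_ubound; exists (scale_nnsfun s (ltW r0)) => /=.
    by move=> x; rewrite EFinM lee_pmul2l.
  by rewrite -sintegralrM.
(* The reverse inequality is the same one for the factor k^-1 and k * f. *)
apply/eqP; rewrite eq_le gen// andbT -lee_pdivrMl//.
rewrite (le_trans (gen k^-1%R _ _ _))// ?invr_gt0//.
- by move=> x; rewrite mule_ge0// lee_fin ltW.
- rewrite le_eqVlt; apply/orP; left; apply/eqP; apply: eq_integral => x _.
  by rewrite muleA -EFinM mulVf ?gt_eqF// mul1e.
Qed.

End integral_scale.

Section wasserstein_scale.
Context {R : realType} {X : ptopologicalType}.
Implicit Types (d : X -> X -> R) (c : R).

Lemma transport_costZ d c (q : probability (borel X * borel X)%type R) :
  0 < c ->
  transport_cost (fun x y => c * d x y) q = ((c ^+ 2)%:E * transport_cost d q)%E.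
Proof.
move=> c0; rewrite /transport_cost -ge0_integral_pZl ?exprn_gt0//.
  by apply: eq_integral => z _; rewrite exprMn EFinM.
by move=> z; rewrite lee_fin sqr_ge0.
Qed.

Lemma fine_pZl (k : R) (x : \bar R) : 0 < k -> fine (k%:E * x)%E = k * fine x.
Proof.
move=> k0; case: x => [r| |]//=.
  by rewrite gt0_muley ?lte_fin// mulr0.
by rewrite gt0_muleNy ?lte_fin// mulr0.
Qed.

Lemma W2Z d c (mu nu : probability (borel X) R) : 0 < c ->
  W2 (fun x y => c * d x y) mu nu = c * W2 d mu nu.
Proof.
move=> c0; rewrite /W2.
have -> : [set transport_cost (fun x y => c * d x y) q | q in coupling mu nu] =
    [set ((c ^+ 2)%:E * x)%E |
      x in [set transport_cost d q | q in coupling mu nu]].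
  by rewrite image_comp; apply: eq_imagel => q _ /=; exact: transport_costZ.
rewrite ereal_inf_pZl ?exprn_gt0// fine_pZl ?exprn_gt0//.
by rewrite sqrtrM ?sqr_ge0// sqrtr_sqr gtr0_norm.
Qed.

Lemma W2_geodesicZ d c (mu : R -> probability (borel X) R) : 0 < c ->
  W2_geodesic (fun x y => c * d x y) mu -> W2_geodesic d mu.
Proof.
move=> c0 geo s t s01 t01; have := geo s t s01 t01.
by rewrite !W2Z// mulrCA => /(mulfI (lt0r_neq0 c0)).
Qed.

Lemma geodesic_metricZ d c : 0 < c ->
  geodesic_metric d -> geodesic_metric (fun x y => c * d x y).
Proof.
move=> c0 [[d0 dE dC dT] geo]; split; first split.
- by move=> x y; rewrite mulr_ge0// ltW.
- move=> x y; rewrite -dE; split => [/eqP|->]; last by rewrite mulr0.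
  by rewrite mulf_eq0 gt_eqF//= => /eqP.
- by move=> x y; rewrite dC.
- by move=> x y z; rewrite -mulrDr ler_pM2l.
- move=> x y; have [g [g0 g1 gE]] := geo x y; exists g; split => // s t s01 t01.
  by rewrite gE// mulrCA.
Qed.

Lemma induces_topologyZ d c : 0 < c ->
  induces_topology d -> induces_topology (fun x y => c * d x y).
Proof.
move=> c0 dtop x A; rewrite dtop; split=> -[r r0 rA].
- exists (c * r); first exact: mulr_gt0.
  by move=> y /=; rewrite ltr_pM2l//; exact: rA.
- exists (r / c); first exact: divr_gt0.
  by move=> y /=; rewrite ltr_pdivlMr// mulrC; exact: rA.
Qed.

End wasserstein_scale.

(** * Lower limits along filters *)

Section liminf.
Context {R : realType}.

Lemma limf_einf_ge {Y : choiceType} {Z : filteredType Y} (f : Z -> \bar R)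
    (F : set_system Z) (x : \bar R) :
  (forall y : R, (y%:E < x)%E -> \forall s \near F, (y%:E <= f s)%E) ->
  (x <= limf_einf f F)%E.
Proof.
move=> lowerF.
have le_lim (y : R) : (y%:E < x)%E -> (y%:E <= limf_einf f F)%E.
  move=> /lowerF Fy; rewrite limf_einfE.
  apply: le_trans (ereal_sup_ubound _); last first.
    by exists [set s | (y%:E <= f s)%E].
  by apply: le_ereal_inf_tmp => _ [s /= ? <-].
case: x le_lim {lowerF} => [r le_lim|le_lim|_]; last exact: leNye.
- apply/lee_subgt0Pr => e e0; rewrite -EFinB le_lim//.
  by rewrite lte_fin ltrBlDr ltrDl.
- by rewrite leye_eq; apply/eqP/eqyP => A _; rewrite le_lim// ltry.
Qed.

Lemma limf_einf_gt_near {Y : choiceType} {Z : filteredType Y} (f : Z -> \bar R)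
    (F : set_system Z) {FF : Filter F} (y : \bar R) :
  (y < limf_einf f F)%E -> \forall s \near F, (y < f s)%E.
Proof.
rewrite limf_einfE => /ereal_sup_gt[_ [V FV <-] yV].
apply: filterS FV => s Vs; apply: lt_le_trans yV _.
by apply: ereal_inf_lbound; exists s.
Qed.

(** A factor tending to [1] is eventually positive and moves a real lower bound
    of [Q] by arbitrarily little.  Working with strict real lower bounds also
    covers infinite lower limits, for which [g * Q] could not be compared with
    [Q] by a difference. *)
Lemma limf_einf_perturb (F G : set_system R) {FF : Filter F} {FG : Filter G}
    (Q h g w : R -> R) (c : R) :
  w @ F --> G -> g @ F --> (1 : R) ->
  (\forall s \near F, h s = g s * Q (w s) + c) ->
  (limf_einf (fun v => (Q v)%:E) G + c%:E
     <= limf_einf (fun s => (h s)%:E) F)%E.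
Proof.
move=> wFG g1 hE; apply: limf_einf_ge => y.
rewrite -lteBlDr// -EFinB => ylt.
(* The room between y - c and y' absorbs the error made by the factor g. *)
have [y' yy' y'lt] : exists2 y' : R, y - c < y' &
    (y'%:E < limf_einf (fun v => (Q v)%:E) G)%E.
  move: ylt; case: (limf_einf _ _) => [r| |]//.
  - rewrite lte_fin => ylt.
    by exists ((y - c + r) / 2); rewrite ?lte_fin ?midf_lt.
  - by move=> _; exists (y - c + 1); rewrite ?ltry// ltrDl.
have Qy' : \forall s \near F, (y'%:E < (Q (w s))%:E)%E.
  exact: (wFG _ (limf_einf_gt_near y'lt)).
have gy' : g s * y' @[s --> F] --> y'.
  by rewrite -[X in _ --> X]mul1r; apply: cvgM => //; exact: cvg_cst.
near=> s.
rewrite lee_fin (near hE s)// -lerBlDr ltW//.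
have gs0 : 0 < g s by near: s; exact: (cvgr_gt _ g1).
apply: (@lt_trans _ _ (g s * y')).
  by near: s; apply: (cvgr_gt _ gy').
by rewrite ltr_pM2l// -lte_fin; near: s.
Unshelve. all: by end_near. Qed.

End liminf.

(** * Lipschitz images of null sets *)

Section lipschitz_null.
Context {R : realType}.
Local Notation mu := (@lebesgue_measure R).
Local Notation l := (@wlength R idfun).

(** A null set has covers by open intervals of arbitrarily small total length,
    and the part of [A] in an interval of length [r] has its image in an
    interval of length [2 * L * r]. *)
Lemma lipschitz_image_negligible (f : R -> R) (A N : set R) (L : R) :
  L.-lipschitz_A f -> mu.-negligible N -> mu.-negligible (f @` (A `&` N)).
Proof.
move=> fL N0.
wlog L0 : L fL / 0 < L.
  move=> /(_ (Num.max L 1)); apply; last by rewrite lt_max ltr01 orbT.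
  move=> z /= Az; apply: le_trans (fL z Az) _.
  by rewrite ler_wpM2r// le_max lexx.
apply/negligible_outer_measure/eqP; rewrite eq_le outer_measure_ge0 andbT.
move/negligible_outer_measure : N0; rewrite outer_measure_open_itv_cover => N0.
rewrite -(mule0 (2 * L)%:E) -N0 -ereal_inf_pZl ?mulr_gt0//.
apply: le_ereal_inf_tmp => _ [_ [I [Iitv NI] <-] <-].
have /choice[J IJ] k : exists J : set R, f @` (A `&` I k) `<=` J /\
    (mu J <= (2 * L)%:E * l (I k))%E.
  have [[a b] /= IkE] := Iitv k.
  have [[x [Ax Ix]]|/set0P/negP/negPn/eqP AI0] :=
      pselect (A `&` I k !=set0); last first.
    exists set0; split; first by rewrite AI0 image_set0.
    by rewrite measure0 mule_ge0 ?wlength_ge0// lee_fin ltW// mulr_gt0.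
  have /andP[ax xb] : a < x < b by move: Ix; rewrite IkE /= in_itv.
  exists `[f x - L * (b - a), f x + L * (b - a)]%classic; split.
    move=> _ [y [Ay Iy] <-] /=.
    have /andP[ay yb] : a < y < b by move: Iy; rewrite IkE /= in_itv.
    rewrite in_itv/= -ler_distl; apply: le_trans (fL (y, x) _) _ => //=.
    by rewrite ler_pM2l// ler_norml; apply/andP; split; lra.
  rewrite lebesgue_measure_itv/= IkE wlength_itv/= !lte_fin.
  rewrite (lt_trans ax xb) ifT; last by nra.
  by rewrite -!EFinD -EFinM lee_fin; lra.
apply: (@le_trans _ _ ((l^* (\bigcup_k J k))%mu)).
  apply: le_outer_measure => _ [y [Ay /NI[k _ Iy]] <-].
  by exists k => //; apply: (IJ k).1; exists y.
apply: le_trans (outer_measure_sigma_subadditive _ _) _.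
rewrite -nneseriesZl//.
by apply: lee_nneseries => // k _; exact: (IJ k).2.
Qed.

End lipschitz_null.

(** * The time change *)

Section time_change.
Context {R : realType} (K C : R).
Hypothesis K0 : K != 0.

Lemma expR_tau (t : R) : 2 * K * t < C ->
  expR (- K * tau K C t) ^+ 2 = C - 2 * K * t.
Proof.
move=> tC; rewrite -expRM_natl /tau.
have -> : 2%:R * (- K * (-1 / (2 * K) * ln (C - 2 * K * t))) =
    ln (C - 2 * K * t) by field.
by rewrite lnK// posrE subr_gt0.
Qed.

Definition tau_inv (s : R) : R := (C - expR (- 2 * K * s)) / (2 * K).

Lemma tauK (t : R) : 2 * K * t < C -> tau_inv (tau K C t) = t.
Proof.
move=> tC; rewrite /tau_inv.
have -> : - 2 * K * tau K C t = 2%:R * (- K * tau K C t) by ring.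
by rewrite expRM_natl expR_tau//; field.
Qed.

Lemma expR_lipschitz (B : R) : (expR B).-lipschitz_[set x | x <= B] (@expR R).
Proof.
have half (x y : R) : x <= y -> y <= B -> expR y - expR x <= expR B * (y - x).
  move=> xy yB; apply: (@le_trans _ _ (expR y * (y - x))).
    have -> : expR x = expR y * expR (x - y) by rewrite -expRD addrC subrK.
    by have := expR_ge1Dx (x - y); have := expR_gt0 y; nra.
  by rewrite ler_wpM2r ?subr_ge0// ler_expR.
move=> [x y] [/= xB yB].
wlog xy : x y xB yB / x <= y.
  by move=> H; have [/H|/ltW/H] := leP x y;
    [exact|rewrite distrC (distrC y); exact].
rewrite distrC (distrC x) !ger0_norm ?subr_ge0 ?ler_expR//; exact: half.
Qed.

Lemma tau_inv_lipschitz (a b : R) :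
  exists L, L.-lipschitz_[set` `]a, b[] tau_inv.
Proof.
(* B bounds the exponent of tau_inv on the whole interval. *)
pose B := `|2 * K| * (`|a| + `|b|).
exists (expR B) => -[x y] [/=]; rewrite !in_itv/= => /andP[ax xb] /andP[ay yb].
have bound (z : R) : a < z -> z < b -> - 2 * K * z <= B.
  move=> az zb; apply: le_trans (ler_norm _) _.
  rewrite /B mulNr mulNr normrN normrM ler_wpM2l// ler_norml.
  have := ler_norm a; have := ler_norm b.
  have := ler_norm (- a); have := ler_norm (- b).
  by rewrite !normrN; lra.
have K2 : 2 * K != 0 by rewrite mulf_neq0.
have -> : tau_inv x - tau_inv y =
    (expR (- 2 * K * y) - expR (- 2 * K * x)) / (2 * K).
  by rewrite /tau_inv; field.
rewrite normrM normfV ler_pdivrMr ?normr_gt0//.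
have /(_ _)/le_trans := @expR_lipschitz B (- 2 * K * y, - 2 * K * x).
apply => /=; first by split; apply: bound.
have -> : - 2 * K * y - - 2 * K * x = (x - y) * (2 * K) by ring.
by rewrite normrM mulrA.
Qed.

Lemma tau_inv_nondecreasing : {homo tau_inv : x y / x <= y}.
Proof.
move=> x y xy; rewrite /tau_inv -subr_ge0.
have -> : (C - expR (- 2 * K * y)) / (2 * K) -
    (C - expR (- 2 * K * x)) / (2 * K) =
    (expR (- 2 * K * x) - expR (- 2 * K * y)) / (2 * K) by field.
(* The two signs of K cancel: both factors change sign with K. *)
have [K_lt0|K_gt0|/eqP] := ltgtP K 0; last by rewrite (negPf K0).
- by rewrite mulr_le0// ?invr_le0 ?subr_le0 ?ler_expR; nra.
- by rewrite mulr_ge0// ?invr_ge0 ?subr_ge0 ?ler_expR; nra.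
Qed.

Lemma tau_increasing (s t : R) : 2 * K * s < C -> 2 * K * t < C ->
  s < t -> tau K C s < tau K C t.
Proof.
move=> sC tC; apply: contraTT; rewrite -!leNgt => /tau_inv_nondecreasing.
by rewrite !tauK.
Qed.

Lemma is_derive_tau (t : R) : 2 * K * t < C ->
  is_derive t 1 (tau K C) (C - 2 * K * t)^-1.
Proof.
move=> tC; have E0 : 0 < C - 2 * K * t by rewrite subr_gt0.
have lnE := is_derive1_ln E0.
have dE : is_derive t 1 (fun s => C - 2 * K * s) (- (2 * K)).
  by apply: is_derive_eq; rewrite add0r mul1r /GRing.scale/= mulr1.
have := @is_derive1_comp _ (@ln R) (fun s => C - 2 * K * s) t _ _ lnE dE.
move=> /(is_deriveZ (-1 / (2 * K))); rewrite /GRing.scale/=.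
have -> : -1 / (2 * K) * ((C - 2 * K * t)^-1 * - (2 * K)) =
    (C - 2 * K * t)^-1 by field; rewrite K0 gt_eqF.
exact.
Qed.

Lemma near_left_domain (t : R) : 2 * K * t < C ->
  \forall s \near t^'-, 2 * K * s < C.
Proof.
move=> tC; have lin : 2 * K * s @[s --> t^'-] --> 2 * K * t.
  by apply: cvg_at_left_filter; apply: cvgM; [exact: cvg_cst|exact: cvg_id].
exact: (cvgr_lt _ lin).
Qed.

Lemma tau_left (t : R) : 2 * K * t < C -> tau K C @ t^'- --> (tau K C t)^'-.
Proof.
move=> tC A At.
have [dt _] := is_derive_tau tC.
have tau_cvg : tau K C @ t^'- --> tau K C t.
  apply: cvg_at_left_filter.
  by apply: differentiable_continuous; apply/derivable1_diffP.
have At' : \forall s \near t^'-, tau K C s < tau K C t -> A (tau K C s) :=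
  tau_cvg _ At.
have lt_t : \forall s \near t^'-, tau K C s < tau K C t.
  near=> s; apply: tau_increasing => //; near: s.
  exact: near_left_domain.
by apply: filterS2 At' lt_t => s; exact.
Unshelve. all: by end_near. Qed.

Lemma tau_slope (t : R) : 2 * K * t < C ->
  (C - 2 * K * s) * ((tau K C t - tau K C s) / (t - s)) @[s --> t^'-]
    --> (1 : R).
Proof.
move=> tC; have E0 : 0 < C - 2 * K * t by rewrite subr_gt0.
(* g extends the difference quotient of tau at t continuously. *)
have [g [gE g_cts gt]] :=
  (is_derive1_caratheodory _ _ _).1 (is_derive_tau tC).
have g_slope :
    (C - 2 * K * s) * g s @[s --> t^'-] --> (C - 2 * K * t) * g t.
  apply: cvg_at_left_filter; apply: cvgM => //.
  apply: cvgB; first exact: cvg_cst.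
  by apply: cvgM; [exact: cvg_cst|exact: cvg_id].
rewrite gt mulfV ?lt0r_neq0// in g_slope.
apply: cvg_trans g_slope; apply: near_eq_cvg; near=> s.
have st : s - t != 0.
  by rewrite subr_eq0 lt_eqF//; near: s; exact: nbhs_left_lt.
by rewrite -(opprB s) -(opprB (tau K C s)) gE invrN mulrNN mulfK.
Unshelve. all: by end_near. Qed.

End time_change.

(** * The rescaled flow *)

Lemma W2sq_d_tilde (R : realType) (X : ptopologicalType)
    (d : R -> X -> X -> R) (K C s : R) (mu nu : probability (borel X) R) :
  K != 0 -> 2 * K * s < C ->
  W2 (d_tilde K C d s) mu nu ^+ 2 =
  (C - 2 * K * s) * W2 (d (tau K C s)) mu nu ^+ 2.
Proof. by move=> K0 sC; rewrite W2Z ?expR_gt0// exprMn expR_tau. Qed.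

(** The discrete product rule for the affine factor [C - 2 * K * t]; the increment
    [a - b] of the original time is inserted to make the original difference
    quotient appear. *)
Lemma affine_product_quotient (F : fieldType) (K C s t a b ws wt vs vt : F) :
  t - s != 0 -> a - b != 0 ->
  vt = (C - 2 * K * t) * wt -> vs = (C - 2 * K * s) * ws ->
  (vt - vs) / (t - s) =
  (C - 2 * K * s) * ((a - b) / (t - s)) * ((wt - ws) / (a - b))
    + - 2 * K * wt.
Proof. by move=> ts ab -> ->; field; rewrite ab ts. Qed.

Lemma dminus_W2sq_time_change (R : realType) (X : ptopologicalType)
    (d : R -> X -> X -> R) (K C t : R) (mu nu : probability (borel X) R) :
  K != 0 -> 2 * K * t < C ->
  (dminus_W2sq d (tau K C t) mu nu
     + (- 2 * K * W2 (d (tau K C t)) mu nu ^+ 2)%:E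
   <= dminus_W2sq (d_tilde K C d) t mu nu)%E.
Proof.
move=> K0 tC; apply: (limf_einf_perturb (tau_left K0 tC) (tau_slope K0 tC)).
near=> s.
have sC : 2 * K * s < C by near: s; exact: near_left_domain.
have st : s < t by near: s; exact: nbhs_left_lt.
have tau_st : tau K C t - tau K C s != 0.
  by rewrite subr_eq0 gt_eqF// tau_increasing.
have ts : t - s != 0 by rewrite subr_eq0 gt_eqF.
exact: (affine_product_quotient ts tau_st
  (W2sq_d_tilde d mu nu K0 tC) (W2sq_d_tilde d mu nu K0 sC)).
Unshelve. all: by end_near. Qed.

Theorem theorem1p11 (R : realType) (X : ptopologicalType) (T : R)
  (d : R -> X -> X -> R) (m : R -> {measure set (borel X) -> \bar R})
  (K : R) (N : \bar R)
  (hT : 0 < T) (hX : compact [set: X])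
  (hstd : standing_assumptions [set` `]0, T[] d m)
  (hK : K != 0) (hN : (0 < N)%E)
  (hflow : super_KN_Ricci_flow [set` `]0, T[] d m K N) :
  forall C : R,
    time_dependent_geodesic_metrics (I_tilde K C [set` `]0, T[]) (d_tilde K C d)
    /\ super_N_Ricci_flow (I_tilde K C [set` `]0, T[])
         (d_tilde K C d) (m_tilde K C m) N.
Proof.
move=> C; split.
  move=> t [_ /hstd.1[geo top]]; split.
    by apply: geodesic_metricZ geo; exact: expR_gt0.
  by apply: induces_topologyZ top; exact: expR_gt0.
(* A bad time of the rescaled flow is the image under tau_inv of a bad time of
   the original flow. *)
have [L tauL] := tau_inv_lipschitz C hK 0 T.
have := lipschitz_image_negligible tauL hflow.
apply: negligibleS => t /= bad.
have [[tC It]|nI] := pselect (I_tilde K C [set` `]0, T[] t); last first.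
  by exfalso; apply: bad => /nI.
exists (tau K C t); last exact: tauK.
split => // good; apply: bad => _ mu geo S0 S1.
have {}geo : W2_geodesic (d (tau K C t)) mu.
  by apply: W2_geodesicZ geo; exact: expR_gt0.
apply: le_trans (good It mu geo S0 S1).
rewrite addeAC leeD2r//.
have -> : (K * W2 (d (tau K C t)) (mu 0) (mu 1) ^+ 2)%:E =
    (- (2^-1)%:E * (- 2 * K * W2 (d (tau K C t)) (mu 0) (mu 1) ^+ 2)%:E)%E.
  by rewrite -EFinN -EFinM; congr EFin; field.
(* The lower derivative may be infinite; distributivity only needs the other
   summand to be real. *)
rewrite -EFinN -muleDr//; last exact: fin_num_adde_defl.
rewrite EFinN !mulNe leeN2 lee_pmul2l ?lte_fin//.
exact: dminus_W2sq_time_change.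
Qed.
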